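(* Let $E$ be a real or complex locally convex topological vector space and $f,g\in\Gamma_0(E)$. Then for any $s\in(0,1)$ we have, for the point-wise order, $$0\leq\Big(\frac12-I_s\Big)\frac{f\nabla_sg-f!_sg}{s(1-s)}\leq f\nabla g-L(f,g)\leq I_s\,\frac{f\nabla_sg-f!_sg}{s(1-s)},$$ where $$I_s:=s\int_0^s\omega(t)\,dt+(1-s)\int_0^{1-s}\omega(t)\,dt,\qquad \omega(t):=\frac{1}{t\Big(\pi^2+\big(\log\frac{t}{1-t}\big)^2\Big)},\quad t\in(0,1).$$
   Context: $E^*$ is the topological dual of $E$, with duality bracket $\langle x^*,x\rangle$. Conventions in $[-\infty,+\infty]$: $a+(+\infty)=+\infty$ for every $a$, $(+\infty)-(+\infty)=+\infty$, $c-(-\infty)=+\infty$, $0\cdot(+\infty)=+\infty$; $a\le b$ means $b-a\ge 0$, with $-\infty\le a\le+\infty$ for all $a$. Functionals are ordered point-wise. $\Gamma_0(E)$ is the set of all convex lower semi-continuous proper functionals $f:E\to\mathbb R\cup\{+\infty\}$. Conjugates: $f^*(x^* )=\sup_{x\in E}\{\Re e\langle x^*,x\rangle-f(x)\}$ on $E^*$; for $\varphi:E^*\to[-\infty,+\infty]$, $\varphi^*(x)=\sup_{x^*\in E^*}\{\Re e\langle x^*,x\rangle-\varphi(x^* )\}$ on $E$. For $\lambda\in(0,1)$: $f\nabla_\lambda g=(1-\lambda)f+\lambda g$, $f!_\lambda g=\big((1-\lambda)f^*+\lambda g^*\big)^*$, $f\sharp_\lambda g=\frac{\sin(\pi\lambda)}{\pi}\int_0^1\frac{t^{\lambda-1}}{(1-t)^\lambda}\,f!_tg\,dt$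 (integral taken point-wise). Write $f\nabla g=f\nabla_{1/2}g$. By convention $f\sharp_0g=f$, $f\sharp_1g=g$. The logarithmic mean is $L(f,g)=\int_0^1 f\sharp_tg\,dt$ (point-wise). *)

(* Defs.v *)
From HB Require Import structures.
From mathcomp Require Import all_boot all_order all_algebra.
From mathcomp Require Import complex.
From mathcomp Require Import all_classical all_reals all_analysis.

Set Implicit Arguments.
Unset Strict Implicit.
Unset Printing Implicit Defensive.

Import Order.TTheory GRing.Theory Num.Theory.
Import numFieldNormedType.Exports.

Local Open Scope classical_set_scope.
Local Open Scope ring_scope.

(* The scalar field K together with its real-part map; the norm topology on
   K is the one carried by K^o. *)
Inductive real_or_complex (R : realType) :
    forall K : numFieldType, (K -> R) -> Prop :=
| real_scalars : @real_or_complex R R (fun a => a)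
| complex_scalars : @real_or_complex R R[i] (@complex.Re R).

(* Sums and differences of extended reals are taken in [ereal_dual_scope],
   where (+oo) + (-oo) = +oo: thus a + (+oo) = +oo for every a,
   (+oo) - (+oo) = +oo and c - (-oo) = +oo. *)

(* Product by a real number. It is the library's product, except that
   0 * (+oo) = +oo, whereas the library has 0 * (+oo) = 0. *)
Definition escale (R : realType) (c : R) (a : \bar R) : \bar R :=
  if (c == 0) && (a == +oo%E) then +oo%E else (c%:E * a)%E.

Section functionals.
Context (R : realType) (K : numFieldType) (re : K -> R) (E : tvsType K).

Record topdual := TopDual {
  topdual_fun :> {linear E -> K^o} ;
  topdual_continuous : continuous topdual_fun
}.

(* The coefficient t ranges over K: when K = R[i], 0 < t < 1 forces t to be
   real. *)
Definition econvex (f : E -> \bar R) : Prop :=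
  forall (x y : E) (t : K), 0 < t < 1 ->
    (f ((1 - t) *: x + t *: y)%R
       <= escale (1 - re t)%R (f x) + escale (re t) (f y))%dE.

Definition eproper (f : E -> \bar R) : Prop :=
  (forall x, f x != -oo%E) /\ (exists x, f x != +oo%E).

Definition Gamma0 (f : E -> \bar R) : Prop :=
  [/\ econvex f, lower_semicontinuous f & eproper f].

Definition conjugate (f : E -> \bar R) (xs : topdual) : \bar R :=
  ereal_sup (range (fun x : E => ((re (xs x))%:E - f x)%dE)).

Definition dual_conjugate (phi : topdual -> \bar R) (x : E) : \bar R :=
  ereal_sup (range (fun xs : topdual => ((re (xs x))%:E - phi xs)%dE)).

End functionals.

Definition arith (R : realType) (T : Type) (l : R) (f g : T -> \bar R) (x : T)
    : \bar R :=
  (escale (1 - l)%R (f x) + escale l (g x))%dE.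

(* [arith], [harm] and [geom] are the weighted arithmetic, harmonic and geometric
   means; [geom] extends to the weights 0 and 1 by convention. *)
Section means.
Context (R : realType) (K : numFieldType) (re : K -> R) (E : tvsType K).
Implicit Types (f g : E -> \bar R) (l : R).

Definition harm l f g : E -> \bar R :=
  dual_conjugate re (arith l (conjugate re f) (conjugate re g)).

Definition geom l f g (x : E) : \bar R :=
  if l == 0 then f x
  else if l == 1 then g x
  else escale (sin (pi * l) / pi)
    (\int[lebesgue_measure]_(t in `]0%R, 1%R[)
       escale (t `^ (l - 1) / (1 - t) `^ l)%R (harm t f g x))%E.

Definition logmean f g (x : E) : \bar R :=
  (\int[lebesgue_measure]_(t in `[0%R, 1%R]) geom t f g x)%E.

End means.

Definition omega (R : realType) (t : R) : R :=
  (t * (pi ^+ 2 + ln (t / (1 - t)) ^+ 2))^-1.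

Definition Icst (R : realType) (s : R) : R :=
  s * (\int[lebesgue_measure]_(t in `]0%R, s[) omega t)%R
  + (1 - s) * (\int[lebesgue_measure]_(t in `]0%R, (1 - s)%R[) omega t)%R.

(* Main.v *)
Require Import Defs.
From mathcomp Require Import all_boot all_order all_algebra.
From mathcomp Require Import all_classical all_reals all_analysis.
From mathcomp Require Import measurable_realfun zify ring lra.

Import Order.TTheory GRing.Theory Num.Theory.
Import numFieldNormedType.Exports.

(* Fix [x]. As a function of [t], the harmonic mean [harm t f g x] is a supremum
   of affine functions bounded by [f x] at [0] and by [g x] at [1]. Exchanging
   the two integrals, [logmean f g x] is the integral of [harm t f g x] against
   the probability density [lmdens t = omega t / (1 - t)] on ]0, 1[, which is
   symmetric about [1/2], so that the arithmetic mean [arith 2^-1 f g x] is the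
   integral of [arith t f g x] against the same density. The gap
   [D t = arith t f g x - harm t f g x] is nonnegative and concave, whence
   [D t >= (t / s) D s] for [t <= s] and [D t >= ((1 - t) / (1 - s)) D s] for
   [t >= s]; exchanging the roles of [s] and [t] bounds [D t] from above.
   Integrating these bounds over ]0, s[ and [s, 1[ gives the constants. *)

Set Implicit Arguments.
Unset Strict Implicit.
Unset Printing Implicit Defensive.

Local Open Scope ring_scope.

Section logarithmic_mean.
Local Open Scope classical_set_scope.
Local Open Scope ring_scope.
Context {R : realType}.
Implicit Types t l : R.
Local Notation mu := (@lebesgue_measure R).

(** * The kernel of the geometric mean and its integral over the weight *)

Definition logit t : R := ln (t / (1 - t)).

(* [lmdens t] is the integral over [l] of the kernel [geom_kernel l t] of
   [geom], computed in [integral_geom_kernel]. *)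
Definition lmdens t : R := (t * (1 - t) * (pi ^+ 2 + logit t ^+ 2))^-1.

Definition geom_kernel l t : R :=
  sin (pi * l) / pi * (t `^ (l - 1) / (1 - t) `^ l).

(** As a function of [l] the kernel is a sine times an exponential, which has an elementary
    primitive. *)
Lemma geom_kernelE l t : 0 < t < 1 ->
  geom_kernel l t = sin (pi * l) * expR (l * logit t) / (pi * t).
Proof.
move=> /andP[t0 t1]; have t10 : 0 < 1 - t by rewrite subr_gt0.
rewrite /geom_kernel /logit ln_div ?posrE// /powR !gt_eqF//= -expRN -expRD.
rewrite (_ : (l - 1) * ln t - l * ln (1 - t) =
  l * (ln t - ln (1 - t)) - ln t); last by ring.
rewrite expRD expRN lnK ?posrE//.
(* [field] would unfold [pi]. *)
move: (pi_gt0 R) (sin _) => + y; move: (pi : R) => p p0; field.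
by rewrite !gt_eqF.
Qed.

(** Obtained from [sin (pi * l) * expR (l * a)] by two integrations by parts, without the final
    division by [pi ^+ 2 + a ^+ 2]. *)
Let prim (a l : R) :=
  expR (l * a) * (a * sin (pi * l) - pi * cos (pi * l)).

Let is_derive_prim (a l : R) :
  is_derive l 1 (prim a) ((pi ^+ 2 + a ^+ 2) * (sin (pi * l) * expR (l * a))).
Proof.
rewrite /prim.
apply: is_derive_eq.
rewrite /GRing.scale/=; move: (pi : R) (expR _) (sin _) (cos _) => p e sn cs.
by ring.
Qed.

Lemma integral_geom_kernel t : 0 < t < 1 ->
  (\int[mu]_(l in `[0%R, 1%R]) (geom_kernel l t)%:E = (lmdens t)%:E)%E.
Proof.
move=> t01; have /andP[t0 t1] := t01; have t10 : 0 < 1 - t by rewrite subr_gt0.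
pose c := ((pi ^+ 2 + logit t ^+ 2) * (pi * t))^-1.
pose P l := c * prim (logit t) l.
have p0 : 0 < (pi : R) by exact: pi_gt0.
have pl0 : pi ^+ 2 + logit t ^+ 2 != 0 :> R.
  by rewrite gt_eqF// ltr_wpDr ?sqr_ge0// exprn_gt0.
have dP l : is_derive l 1 P (geom_kernel l t).
  apply: is_derive_eq; rewrite geom_kernelE// /c /GRing.scale/=.
  move: (sin _) (expR _) pl0 p0; move: (pi : R) (logit t) => p a y z pl0 p0.
  by field; rewrite ?pl0 ?gt_eqF.
have cP : continuous P.
  move=> l; apply/differentiable_continuous/derivable1_diffP.
  exact: ex_derive.
rewrite (@continuous_FTC2 _ _ P) //.
(* At [l = 1] and [l = 0] the sine vanishes and [prim] equals [pi * t / (1 - t)] and [- pi], with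
   difference [pi / (1 - t)]. *)
- rewrite /P /prim /c mulr0 mulr1 !mul0r expR0 mul1r sin0 cos0 cospi sinpi.
  rewrite mulr0 mulr1 mulrN1 sub0r opprK mul1r -EFinB; congr (_%:E).
  rewrite /lmdens /logit lnK ?posrE ?divr_gt0//.
  move: pl0 p0; rewrite /logit; move: (pi : R) (ln _) => p a pl0 p0.
  by field; rewrite pl0 ?gt_eqF.
- apply: derivable_within_continuous => l _.
  rewrite (_ : geom_kernel^~ t = fun l =>
    sin (pi * l) * expR (l * logit t) / (pi * t)).
    by apply: ex_derive.
  by apply/funext => k; rewrite geom_kernelE.
- split=> [l _||]; first exact: ex_derive.
  + exact/cvg_at_right_filter/cP.
  + exact/cvg_at_left_filter/cP.
- by move=> l _; rewrite derive1E; apply: derive_val.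
Qed.

(** * Symmetry, regularity and total mass of the density *)

Lemma logit_onem t : 0 < t < 1 -> logit (1 - t) = - logit t.
Proof.
move=> /andP[t0 t1]; have t10 : 0 < 1 - t by rewrite subr_gt0.
rewrite /logit opprB addrCA subrr addr0 -[in RHS]invf_div lnV ?opprK//.
by rewrite posrE divr_gt0.
Qed.

Lemma lmdens_onem t : 0 < t < 1 -> lmdens (1 - t) = lmdens t.
Proof.
move=> t01; rewrite /lmdens logit_onem// sqrrN opprB addrCA subrr addr0.
by rewrite (mulrC t).
Qed.

Lemma pi2D_gt0 (a : R) : 0 < pi ^+ 2 + a ^+ 2.
Proof. by rewrite ltr_wpDr ?sqr_ge0// exprn_gt0// pi_gt0. Qed.

Lemma lmdens_ge0 t : 0 < t < 1 -> 0 <= lmdens t.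
Proof.
move=> /andP[t0 t1]; rewrite /lmdens invr_ge0 mulr_ge0 ?(ltW (pi2D_gt0 _))//.
by rewrite mulr_ge0 ?subr_ge0 ?ltW.
Qed.

Lemma is_derive_logit t : 0 < t < 1 -> is_derive t 1 logit (t * (1 - t))^-1.
Proof.
move=> /andP[t0 t1]; have t10 : 0 < 1 - t by rewrite subr_gt0.
have dV : is_derive t 1 (fun x => x / (1 - x)) ((1 - t) ^- 2).
  have t10' : 1 - t != 0 by rewrite gt_eqF.
  have := @is_deriveV _ (fun x : R => 1 - x) t _ 1 t10' _ => dV.
  apply: is_derive_eq; rewrite /GRing.scale/=; field; rewrite ?gt_eqF//.
have dL : is_derive (t / (1 - t)) 1 (@ln R) (t / (1 - t))^-1.
  by apply: is_derive1_ln; rewrite divr_gt0.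
rewrite /logit; apply: is_derive_eq.
by rewrite /GRing.scale/=; field; rewrite ?gt_eqF.
Qed.

Lemma continuous_lmdens t : 0 < t < 1 -> {for t, continuous lmdens}.
Proof.
move=> t01; have /andP[t0 t1] := t01; have t10 : 0 < 1 - t by rewrite subr_gt0.
apply: continuousV.
  by rewrite mulf_neq0 ?mulf_neq0 ?gt_eqF ?pi2D_gt0.
apply/differentiable_continuous/derivable1_diffP.
have := is_derive_logit t01 => dl.
by apply: ex_derive.
Qed.

Lemma measurable_lmdens : measurable_fun (`]0, 1[%classic : set R) lmdens.
Proof.
apply: open_continuous_measurable_fun; first exact: interval_open.
by move=> t; rewrite inE/= in_itv/= => /continuous_lmdens.
Qed.

(** With [u = logit t] the density becomes [du / (pi ^+ 2 + u ^+ 2)], a Cauchy law, whose mass comes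
    from the limits of the arctangent. The integral is computed on compact intervals exhausting ]0,
    1[. *)
Lemma integral_lmdens : (\int[mu]_(t in `]0%R, 1%R[) (lmdens t)%:E = 1)%E.
Proof.
pose W t := pi^-1 * atan (logit t / pi).
(* As [a 0 = 2^-1] gives an interval reduced to a point, only the indices [n.+1] are used; there
   [logit (a n.+1) = - ln n.+2%:R]. *)
pose a n : R := n.+2%:R^-1.
pose I n := [set` `[a n, 1 - a n]].
have p0 : 0 < (pi : R) by exact: pi_gt0.
have a0 n : 0 < a n by rewrite invr_gt0.
have a2 n : a n.+1 < 2^-1 by rewrite /a ltf_pV2 ?posrE// ltr_nat.
have dW t : 0 < t < 1 -> is_derive t 1 W (lmdens t).
  move=> t01; have dl := is_derive_logit t01; have /andP[t0 t1] := t01.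
  have t10 : 0 < 1 - t by rewrite subr_gt0.
  apply: is_derive_eq; rewrite /GRing.scale/= /lmdens; move: (logit _) => x.
  have := pi2D_gt0 x; have : 0 < 1 + (x / pi) ^+ 2.
    by rewrite ltr_wpDr ?sqr_ge0.
  move: p0; move: (pi : R) => p p0 h1 h2.
  by field; rewrite ?gt_eqF//.
have a1 n : 0 < 1 - a n.+1.
  by rewrite subr_gt0 (lt_trans (a2 n))// invf_lt1 ?ltr1n.
have intI n : (\int[mu]_(t in I n.+1) (lmdens t)%:E
    = (2 / pi * atan (ln n.+2%:R / pi))%:E)%E.
  have in01 t : t \in `[a n.+1, 1 - a n.+1] -> 0 < t < 1.
    rewrite in_itv/= => /andP[at_ ta]; rewrite (lt_le_trans (a0 _) at_)/=.
    by rewrite (le_lt_trans ta)// gtrDl oppr_lt0.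
  have aa : a n.+1 < 1 - a n.+1 by move: (a2 n); lra.
  have ain : a n.+1 \in `[a n.+1, 1 - a n.+1] by rewrite in_itv/= lexx ltW.
  have bin : 1 - a n.+1 \in `[a n.+1, 1 - a n.+1].
    by rewrite in_itv/= lexx ltW.
  rewrite /I (@continuous_FTC2 _ _ W)//.
  - rewrite /W logit_onem ?in01// mulNr atanN -EFinB mulrN.
    have -> : logit (a n.+1) = - ln n.+2%:R.
      rewrite /logit /a -lnV ?posrE//; congr ln.
      have : 0 < n.+2%:R :> R by rewrite ltr0n.
      rewrite [n.+3%:R]mulrS; move: (n.+2%:R : R) => m m0.
      by field; rewrite ?gt_eqF ?addr_gt0//; lra.
    rewrite mulNr atanN mulrN !opprK; congr (_%:E).
    by rewrite mulrDl mul1r mulrDl.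
  - apply: continuous_in_subspaceT => t; rewrite inE/= => /in01.
    exact: continuous_lmdens.
  - split=> [t tI||].
    + by have := dW _ (in01 _ (subset_itv_oo_cc tI)) => ?; apply: ex_derive.
    + have ? := dW _ (in01 _ ain).
      apply: cvg_at_right_filter.
      by apply/differentiable_continuous/derivable1_diffP; apply: ex_derive.
    + have ? := dW _ (in01 _ bin).
      apply: cvg_at_left_filter.
      by apply/differentiable_continuous/derivable1_diffP; apply: ex_derive.
  - move=> t tI; rewrite derive1E.
    by have ? := dW _ (in01 _ (subset_itv_oo_cc tI)); apply: derive_val.
have lny : ln n.+2%:R / pi @[n --> \oo] --> (+oo : set_system R).
  apply/cvgryPge => A; near=> n.
  rewrite ler_pdivlMr ?pi_gt0// -ler_expR lnK ?posrE//.
  apply: (@le_trans _ _ n%:R); last by rewrite ler_nat -addn2 leq_addr.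
  by near: n; exact: nbhs_infty_ger.
have cv1 : (\int[mu]_(t in I n.+1) (lmdens t)%:E @[n --> \oo] --> 1)%E.
  under eq_cvg do rewrite intI.
  apply: cvg_EFin; first by near=> n.
  rewrite [X in _ --> X](_ : _ = 2 / pi * (pi / 2)); last first.
    by rewrite mulf_div (mulrC 2) divff// mulf_neq0 ?gt_eqF.
  apply: cvgM; first exact: cvg_cst.
  exact: (cvg_comp _ _ lny (@cvgy_atan R)).
have -> : (`]0, 1[%classic : set R) = \bigcup_n I n.+1.
  apply/seteqP; split=> t /=.
    rewrite in_itv/= => /andP[t0 t1].
    have m0 : 0 < Num.min t (1 - t) by rewrite lt_min t0 subr_gt0.
    have /cvgrPdist_lt/(_ _ m0)[n _ /(_ _ (leqnn n))/=] := @cvg_harmonic R.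
    rewrite sub0r normrN ger0_norm// lt_min => /andP[nt nt1].
    have an : a n.+1 <= n.+1%:R^-1.
      by rewrite /a lef_pV2 ?posrE ?ltr0n// ler_nat; lia.
    exists n => //; rewrite /I/= in_itv/=; move: nt nt1 an.
    move: (a n.+1) (n.+1%:R^-1) => x y ? ? ?; apply/andP; split; lra.
  move=> [n _]; rewrite /I/= !in_itv/= => /andP[? ?].
  by apply/andP; split; move: (a0 n.+1); lra.
have IS n t : I n.+1 t -> 0 < t < 1.
  rewrite /I/= in_itv/= => /andP[? ?]; have := a0 n.+1.
  by move=> ?; apply/andP; split; lra.
suff cv2 : (\int[mu]_(t in I n.+1) (lmdens t)%:E @[n --> \oo] -->
    \int[mu]_(t in \bigcup_n I n.+1) (lmdens t)%:E)%E.
  exact: cvg_unique cv2 cv1.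
apply: (@ge0_nondecreasing_set_cvg_integral _ (measurableTypeR R) _
  (fun n => I n.+1)).
- move=> m n mn; rewrite subsetEset => t; rewrite /I/= !in_itv/= => /andP[? ?].
  have : a n.+1 <= a m.+1 by rewrite /a lef_pV2 ?posrE ?ltr0n// ler_nat; lia.
  by move=> ?; apply/andP; split; lra.
- by move=> n; exact: measurable_itv.
- move=> n; apply/measurable_EFinP.
  by apply: measurable_funS measurable_lmdens => // t /IS; rewrite /= in_itv.
- by move=> n t /IS t01; rewrite lee_fin lmdens_ge0.
Unshelve. all: end_near. Qed.

(** * The reflection of ]0, 1[ and the moments of the density *)

Lemma lebesgue_measure_onem (A : set (measurableTypeR R)) : measurable A ->
  pushforward mu (fun t : R => 1 - t : measurableTypeR R) A = mu A.
Proof.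
move=> mA.
have mf : measurable_fun [set: measurableTypeR R]
    (fun t => 1 - t : measurableTypeR R) by exact: measurable_funB.
(* Lebesgue measure is determined by its values on the intervals []a, b]]; the preimage of such an
   interval is [[1 - b, 1 - a[], of the same length. *)
apply/esym/(@lebesgue_measure_unique _ (pushforward mu
  (fun t => 1 - t : measurableTypeR R))) => //= _ [[a b]] _ <-.
rewrite /pushforward (_ : _ @^-1` _ = `[1 - b, 1 - a[%classic).
  rewrite !lebesgue_measure_itv/= !lte_fin ltrD2l ltrN2; case: ifPn => // _.
  by rewrite -!EFinB; congr (_%:E); lra.
apply/seteqP; split=> x /=; rewrite !in_itv/= => /andP[? ?].
  by apply/andP; split; lra.
by apply/andP; split; lra.
Qed.

Lemma integral_onem (D : set (measurableTypeR R)) (f : R -> \bar R) :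
  measurable D -> measurable_fun D f -> (forall t, D t -> 0 <= f t)%E ->
  (\int[mu]_(t in D) f t =
   \int[mu]_(t in (fun t : R => 1 - t)%R @^-1` D) f (1 - t)%R)%E.
Proof.
move=> mD mf f0.
have m1 : measurable_fun [set: measurableTypeR R]
    (fun t => 1 - t : measurableTypeR R) by exact: measurable_funB.
rewrite -(@ge0_integral_pushforward _ _ _ _ _ _ m1 mu _ f)//.
  apply: eq_measure_integral => A mA _.
  exact/esym/lebesgue_measure_onem.
by move=> t /[!inE]; exact: f0.
Qed.

Local Notation I01 := (`]0, 1[%classic : set (measurableTypeR R)).

Lemma integrable_lmdens (h : R -> R) (M : R) : measurable_fun I01 h ->
  (forall t, 0 < t < 1 -> `|h t| <= M) ->
  mu.-integrable I01 (EFin \o (fun t => h t * lmdens t)).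
Proof.
move=> mh hM.
apply: (@le_integrable _ _ _ mu I01 _ _ (fun t => (M * lmdens t)%:E)) => //.
- apply/measurable_EFinP; apply: measurable_funM => //.
  exact: measurable_lmdens.
- move=> t /=; rewrite in_itv/= => t01.
  rewrite lee_fin !normrM ler_wpM2r ?normr_ge0// (le_trans (hM _ t01))//.
  exact: ler_norm.
- apply/integrableP; split.
    apply/measurable_EFinP; apply: measurable_funM => //.
    exact: measurable_lmdens.
  under eq_integral => t.
    rewrite inE/= in_itv/= => t01.
    rewrite normrM (ger0_norm (lmdens_ge0 t01)) EFinM; over.
  rewrite ge0_integralZl//.
  + by rewrite integral_lmdens mule1 ltry.
  + by apply/measurable_EFinP; exact: measurable_lmdens.
  + by move=> t /=; rewrite in_itv/= => t01; rewrite lee_fin lmdens_ge0.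
Qed.

(** Integrals of [omega] are thus partial moments of the density, which is how [Icst] arises. *)
Lemma omega_lmdens t : 0 < t < 1 -> omega t = (1 - t) * lmdens t.
Proof.
move=> /andP[t0 t1]; have t10 : 0 < 1 - t by rewrite subr_gt0.
rewrite /omega /lmdens /logit; have := pi2D_gt0 (ln (t / (1 - t))).
by move: (pi ^+ 2 + _) => y y0; field; rewrite ?gt_eqF.
Qed.

Lemma integrable_lmdens_id :
  mu.-integrable I01 (EFin \o (fun t => t * lmdens t)).
Proof.
apply: (@integrable_lmdens _ 1) => // t /andP[t0 t1].
by rewrite gtr0_norm// ltW.
Qed.

Lemma integrable_lmdens_onem :
  mu.-integrable I01 (EFin \o (fun t => (1 - t) * lmdens t)).
Proof.
apply: (@integrable_lmdens _ 1); first exact: measurable_funB.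
by move=> t /andP[t0 t1]; rewrite ger0_norm ?subr_ge0 1?ltW// ltrBlDr ltrDl.
Qed.

Lemma Rintegral_lmdens_refl (D : set (measurableTypeR R)) :
  measurable D -> D `<=` I01 ->
  \int[mu]_(t in D) (t * lmdens t) =
  \int[mu]_(t in (fun t : R => 1 - t) @^-1` D) ((1 - t) * lmdens t).
Proof.
move=> mD DI; rewrite /Rintegral integral_onem//.
- congr fine; apply: eq_integral => t; rewrite inE/= => /DI/=.
  rewrite in_itv/= => /andP[? ?]; rewrite lmdens_onem//.
  by apply/andP; split; lra.
- exact: measurable_funS DI (measurable_int _ integrable_lmdens_id).
- move=> t /DI/=; rewrite in_itv/= => t01.
  rewrite lee_fin mulr_ge0 ?lmdens_ge0//.
  by case/andP: t01 => /ltW.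
Qed.

(** By symmetry the integrals of [t] and [1 - t] against the density agree, and they add up to its
    total mass [1]. *)
Lemma Rintegral_lmdens_id : \int[mu]_(t in I01) (t * lmdens t) = 2^-1.
Proof.
have e : \int[mu]_(t in I01) (t * lmdens t) =
    \int[mu]_(t in I01) ((1 - t) * lmdens t).
  rewrite Rintegral_lmdens_refl//; congr Rintegral.
  apply/seteqP; split=> t /=; rewrite !in_itv/= => /andP[? ?].
    by apply/andP; split; lra.
  by apply/andP; split; lra.
have s1 : \int[mu]_(t in I01) (t * lmdens t + (1 - t) * lmdens t) = 1.
  under eq_Rintegral do rewrite -mulrDl addrC subrK mul1r.
  by rewrite /Rintegral integral_lmdens.
move: s1; rewrite RintegralD//; first last.
- exact: integrable_lmdens_onem.
- exact: integrable_lmdens_id.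
rewrite -e; clear.
by move: (\int[mu]_(t in _) _) => x ?; lra.
Qed.

Lemma Rintegral_lmdens_onem : \int[mu]_(t in I01) ((1 - t) * lmdens t) = 2^-1.
Proof.
rewrite -Rintegral_lmdens_id Rintegral_lmdens_refl//; congr Rintegral.
apply/seteqP; split=> t /=; rewrite !in_itv/= => /andP[? ?].
  by apply/andP; split; lra.
by apply/andP; split; lra.
Qed.

Lemma I01_setU (s : R) : 0 < s < 1 ->
  I01 = (`]0, s[%classic : set (measurableTypeR R)) `|` `[s, 1[.
Proof.
move=> s01; apply/seteqP; split=> t /=; rewrite !in_itv/=.
  by move=> /andP[-> ->]/=; rewrite andbT; case: (ltP t s); [left|right].
by case => /andP[? ?]; apply/andP; split; lra.
Qed.

Lemma Rintegral_I01_split (s : R) (h : R -> R) : 0 < s < 1 ->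
  mu.-integrable I01 (EFin \o h) ->
  \int[mu]_(t in I01) h t =
  \int[mu]_(t in `]0, s[) h t + \int[mu]_(t in `[s, 1[) h t.
Proof.
move=> s01; rewrite {1 2}(I01_setU s01) => ih; apply: Rintegral_setU => //.
apply/disj_setPS => t /=; rewrite !in_itv/= => -[/andP[_ ts] /andP[st _]].
by move: ts; rewrite ltNge st.
Qed.

Lemma Rintegral_omega_lo (s : R) : 0 < s < 1 ->
  \int[mu]_(t in `]0, s[) ((1 - t) * lmdens t) =
  \int[mu]_(t in `]0, s[) omega t.
Proof.
move=> /andP[s0 s1]; apply: eq_Rintegral => t.
rewrite inE/= in_itv/= => /andP[t0 ts].
by rewrite omega_lmdens// t0 (lt_trans ts).
Qed.

Lemma Rintegral_onem_hi (s : R) : 0 < s < 1 ->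
  \int[mu]_(t in `[s, 1[) ((1 - t) * lmdens t) =
  2^-1 - \int[mu]_(t in `]0, s[) omega t.
Proof.
move=> s01; rewrite -Rintegral_omega_lo//.
have := Rintegral_I01_split s01 integrable_lmdens_onem.
by rewrite Rintegral_lmdens_onem => ->; rewrite addrAC subrr add0r.
Qed.

Lemma Rintegral_id_hi (s : R) : 0 < s < 1 ->
  \int[mu]_(t in `[s, 1[) (t * lmdens t) = \int[mu]_(t in `]0, 1 - s[) omega t.
Proof.
move=> /andP[s0 s1]; rewrite Rintegral_lmdens_refl//; last first.
  by move=> t /=; rewrite !in_itv/= => /andP[? ?]; apply/andP; split; lra.
rewrite -Rintegral_omega_lo; last by apply/andP; split; lra.
(* The reflection turns [[s, 1[] into []0, 1 - s]]; the right-hand integral gets the same closed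
   endpoint, of measure zero. *)
rewrite Rintegral_itv_bndo_bndc; last first.
  apply: integrableS integrable_lmdens_onem => // t /=.
  by rewrite !in_itv/= => /andP[? ?]; apply/andP; split; lra.
congr Rintegral; apply/seteqP; split=> t /=; rewrite !in_itv/= => /andP[? ?].
  by apply/andP; split; lra.
by apply/andP; split; lra.
Qed.

Lemma Rintegral_id_lo (s : R) : 0 < s < 1 ->
  \int[mu]_(t in `]0, s[) (t * lmdens t) =
  2^-1 - \int[mu]_(t in `]0, 1 - s[) omega t.
Proof.
move=> s01; rewrite -Rintegral_id_hi//.
have := Rintegral_I01_split s01 integrable_lmdens_id.
by rewrite Rintegral_lmdens_id => ->; rewrite addrK.
Qed.

Lemma Rintegral_omega_itv (s : R) : 0 < s < 1 ->
  0 <= \int[mu]_(t in `]0, s[) omega t <= 2^-1.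
Proof.
move=> s01; apply/andP; split.
  apply: Rintegral_ge0 => t /=; rewrite in_itv/= => /andP[t0 ts].
  by rewrite /omega invr_ge0 mulr_ge0 ?(ltW t0)// ltW// pi2D_gt0.
rewrite -subr_ge0 -Rintegral_onem_hi//; have /andP[s0 s1] := s01.
apply: Rintegral_ge0 => t /=; rewrite in_itv/= => /andP[st t1].
by rewrite mulr_ge0 ?subr_ge0 ?(ltW t1)// lmdens_ge0// t1 (lt_le_trans s0).
Qed.

(** [Icst s] is a convex combination of two integrals of [omega], each in [0, 1/2]. *)
Lemma Icst_itv (s : R) : 0 < s < 1 -> 0 <= Icst s <= 2^-1.
Proof.
move=> s01; have /andP[s0 s1] := s01.
have /Rintegral_omega_itv/andP[] : 0 < 1 - s < 1 by apply/andP; split; lra.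
have /andP[] := Rintegral_omega_itv s01; rewrite /Icst.
move: (\int[mu]_(t in _) _) (\int[mu]_(t in _) _) => x y x0 x1 y0 y1.
by apply/andP; split; nra.
Qed.

(** * Integration of the bounds on the gap *)

(** The last two hypotheses say that [D t / t] is nonincreasing and [D t / (1 - t)] nondecreasing.
    Comparison with the values at [s] encloses [D] between the affine functions [t * (D s / s)] and
    [(1 - t) * (D s / (1 - s))]: the first is the lower one before [s], the upper one after [s]. *)
Lemma gap_bounds (s : R) (D : R -> R) : 0 < s < 1 ->
  mu.-integrable I01 (EFin \o (fun t => D t * lmdens t)) ->
  (forall t r, 0 < t -> t <= r -> r < 1 -> t * D r <= r * D t) ->
  (forall t r, 0 < r -> r <= t -> t < 1 -> (1 - t) * D r <= (1 - r) * D t) ->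
  (2^-1 - Icst s) * ((s * (1 - s))^-1 * D s) <=
    \int[mu]_(t in I01) (D t * lmdens t) <=
  Icst s * ((s * (1 - s))^-1 * D s).
Proof.
move=> s01 iD Dl Dr; have /andP[s0 s1] := s01.
have s10 : 0 < 1 - s by rewrite subr_gt0.
have lo01 : (`]0, s[ : set (measurableTypeR R)) `<=` I01.
  by rewrite (I01_setU s01); exact: subsetUl.
have hi01 : (`[s, 1[ : set (measurableTypeR R)) `<=` I01.
  by rewrite (I01_setU s01); exact: subsetUr.
have iZ (A : set (measurableTypeR R)) (c : R) (h : R -> R) :
    A `<=` I01 -> measurable A -> mu.-integrable I01 (EFin \o h) ->
    mu.-integrable A (EFin \o (fun t => c * h t)).
  move=> AI mA ih.
  rewrite (_ : EFin \o _ = fun t => (c%:E * (EFin \o h) t)%E)//.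
  apply: integrableZl => //.
  exact: integrableS ih.
have Zint (A : set (measurableTypeR R)) (c : R) (h : R -> R) :
    A `<=` I01 -> measurable A -> mu.-integrable I01 (EFin \o h) ->
    \int[mu]_(t in A) (c * h t) = c * \int[mu]_(t in A) h t.
  by move=> AI mA ih; apply: RintegralZl => //; exact: integrableS ih.
have llo : D s / s * (2^-1 - \int[mu]_(t in `]0, 1 - s[) omega t) <=
    \int[mu]_(t in `]0, s[) (D t * lmdens t).
  rewrite -Rintegral_id_lo// -Zint//; last exact: integrable_lmdens_id.
  apply: le_Rintegral => //.
  - by apply: iZ => //; exact: integrable_lmdens_id.
  - exact: integrableS iD.
  move=> t /[dup] /lo01/=; rewrite !in_itv/= => t01 /andP[t0 ts].
  rewrite mulrA ler_wpM2r ?lmdens_ge0// mulrAC ler_pdivrMr//.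
  by rewrite mulrC (mulrC (D t)) Dl// ltW.
have lhi : D s / (1 - s) * (2^-1 - \int[mu]_(t in `]0, s[) omega t) <=
    \int[mu]_(t in `[s, 1[) (D t * lmdens t).
  rewrite -Rintegral_onem_hi// -Zint//; last exact: integrable_lmdens_onem.
  apply: le_Rintegral => //.
  - by apply: iZ => //; exact: integrable_lmdens_onem.
  - exact: integrableS iD.
  move=> t /[dup] /hi01/=; rewrite !in_itv/= => t01 /andP[t0 ts].
  rewrite mulrA ler_wpM2r ?lmdens_ge0// mulrAC ler_pdivrMr//.
  by rewrite mulrC (mulrC (D t)) Dr.
have ulo : \int[mu]_(t in `]0, s[) (D t * lmdens t) <=
    D s / (1 - s) * \int[mu]_(t in `]0, s[) omega t.
  rewrite -Rintegral_omega_lo// -Zint//; last exact: integrable_lmdens_onem.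
  apply: le_Rintegral => //.
  - exact: integrableS iD.
  - by apply: iZ => //; exact: integrable_lmdens_onem.
  move=> t /[dup] /lo01/=; rewrite !in_itv/= => t01 /andP[t0 ts].
  rewrite [leRHS]mulrA ler_wpM2r ?lmdens_ge0// mulrAC ler_pdivlMr//.
  by rewrite mulrC (mulrC (D s)) Dr// ltW.
have uhi : \int[mu]_(t in `[s, 1[) (D t * lmdens t) <=
    D s / s * \int[mu]_(t in `]0, 1 - s[) omega t.
  rewrite -Rintegral_id_hi// -Zint//; last exact: integrable_lmdens_id.
  apply: le_Rintegral => //.
  - exact: integrableS iD.
  - by apply: iZ => //; exact: integrable_lmdens_id.
  move=> t /[dup] /hi01/=; rewrite !in_itv/= => t01 /andP[t0 ts].
  rewrite [leRHS]mulrA ler_wpM2r ?lmdens_ge0// mulrAC ler_pdivlMr//.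
  by rewrite mulrC (mulrC (D s)) Dl.
(* Over the common denominator [s * (1 - s)] the factors [D s / s] and [D s / (1 - s)] become
   [(1 - s) * D s] and [s * D s], which carry the weights of [Icst]. *)
rewrite (Rintegral_I01_split s01 iD) /Icst.
apply/andP; split.
  apply: le_trans (lerD llo lhi); rewrite le_eqVlt; apply/orP; left; apply/eqP.
  move: (\int[mu]_(t in _) omega t) (\int[mu]_(t in _) omega t) => x y.
  by field; rewrite ?gt_eqF.
apply: le_trans (lerD ulo uhi) _; rewrite le_eqVlt; apply/orP; left; apply/eqP.
move: (\int[mu]_(t in _) omega t) (\int[mu]_(t in _) omega t) => x y.
by field; rewrite ?gt_eqF.
Qed.

(** * Exchange of the two integrals *)

Lemma mule_cstB (c : R) (x y : \bar R) : 0 < c ->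
  (c%:E * (x - y) = c%:E * x - c%:E * y)%E.
Proof.
move=> c0; have cE : (0 < c%:E)%E by rewrite lte_fin.
case: x y => [x| |] [y| |];
  rewrite ?(addNye, addeNy, addye, addey)// ?(gt0_muley, gt0_muleNy)//=;
  rewrite -!EFinM -?EFinB ?mulrBr ?(addNye, addeNy, addye, addey)//.
Qed.

(** The positive and negative parts scale separately, and a positive real factor distributes over
    their difference even when both are infinite. *)
Lemma integral_cstM (D : set (measurableTypeR R)) (c : R) (f : R -> \bar R) :
  0 < c -> measurable D -> measurable_fun D f ->
  (\int[mu]_(t in D) (c%:E * f t) = c%:E * \int[mu]_(t in D) f t)%E.
Proof.
move=> c0 mD mf; rewrite integralE [in RHS]integralE mule_cstB//.
rewrite ge0_funeposM ?ltW// ge0_funenegM ?ltW//.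
rewrite !ge0_integralZl_EFin ?ltW//.
- exact: measurable_funeneg.
- exact: measurable_funepos.
Qed.

Lemma geom_kernel_ge0 l t : 0 < l < 1 -> 0 <= geom_kernel l t.
Proof.
move=> /andP[l0 l1]; rewrite /geom_kernel.
rewrite mulr_ge0 ?divr_ge0 ?powR_ge0 ?pi_ge0//.
rewrite sin_ge0_pi// mulr_ge0 ?pi_ge0 ?(ltW l0)//=.
by rewrite ler_piMr ?pi_ge0// ltW.
Qed.

(* The indicator is put in [geom_kernelI], and powers are replaced by [expR], to
   get a function which is measurable on the whole plane. *)
Definition geom_kernelI (x : R * R) : R :=
  \1_(I01 : set R) x.1 *
  (sin (pi * x.1) / pi * expR (x.1 * (ln x.2 - ln (1 - x.2)) - ln x.2)).

Lemma geom_kernelIE l t : 0 < t < 1 ->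
  geom_kernelI (l, t) = \1_(I01 : set R) l * geom_kernel l t.
Proof.
move=> t01; have /andP[t0 t1] := t01; have t10 : 0 < 1 - t by rewrite subr_gt0.
rewrite /geom_kernelI geom_kernelE// /logit ln_div ?posrE//=.
rewrite expRD expRN lnK ?posrE//.
congr (_ * _); move: (pi_gt0 R) (sin _) (expR _) => + y z.
by move: (pi : R) => p p0; field; rewrite ?gt_eqF.
Qed.

Lemma measurable_geom_kernelI :
  measurable_fun [set: measurableTypeR R * measurableTypeR R] geom_kernelI.
Proof.
have m1 : measurable_fun [set: measurableTypeR R * measurableTypeR R] fst.
  exact: measurable_fst.
have m2 : measurable_fun [set: measurableTypeR R * measurableTypeR R] snd.
  exact: measurable_snd.
have mln2 : measurable_fun [set: measurableTypeR R * measurableTypeR R]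
    (fun x => ln x.2).
  by apply: measurableT_comp => //; exact: measurable_ln.
apply: measurable_funM.
  by apply: measurableT_comp => //; exact: measurable_indic.
apply: measurable_funM.
  apply: measurable_funM => //.
  apply: measurableT_comp => //; last exact: measurable_funM.
  by apply: continuous_measurable_fun; exact: continuous_sin.
apply: measurableT_comp; first exact: measurable_expR.
apply: measurable_funB => //; apply: measurable_funM => //.
apply: measurable_funB => //.
apply: measurableT_comp; first exact: measurable_ln.
exact: measurable_funB.
Qed.

Lemma measurable_geom_kernelI1 t :
  measurable_fun [set: measurableTypeR R] (fun l => geom_kernelI (l, t)).
Proof.
apply: (measurableT_comp measurable_geom_kernelI).
exact: (@pair2_measurable _ _ (measurableTypeR R) (measurableTypeR R) t).
Qed.

Lemma measurable_geom_kernelI2 l :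
  measurable_fun [set: measurableTypeR R] (fun t => geom_kernelI (l, t)).
Proof.
apply: (measurableT_comp measurable_geom_kernelI).
exact: (@pair1_measurable _ _ (measurableTypeR R) (measurableTypeR R) l).
Qed.

Lemma geom_kernelI_ge0 l t : 0 < t < 1 -> 0 <= geom_kernelI (l, t).
Proof.
move=> t01; rewrite geom_kernelIE// indicE.
case: (boolP (l \in _)); rewrite ?mul0r// inE/= in_itv/= => l01.
by rewrite mul1r geom_kernel_ge0.
Qed.

Lemma integral_geom_kernelI t : 0 < t < 1 ->
  (\int[mu]_l (geom_kernelI (l, t))%:E = (lmdens t)%:E)%E.
Proof.
move=> t01; rewrite -integral_geom_kernel// integral_itv_bndoo; last first.
  apply/measurable_EFinP.
  apply: (eq_measurable_fun (fun l => geom_kernelI (l, t))).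
    by move=> l lI; rewrite geom_kernelIE// indicE lI mul1r.
  exact: measurable_funTS (measurable_geom_kernelI1 t).
rewrite [RHS]integral_mkcond; apply: eq_integral => l _.
rewrite geom_kernelIE// indicE /patch; case: ifPn; rewrite ?mul1r ?mul0r//.
Qed.

Lemma integral_geom_kernelI_cst t (c : R) : 0 < t < 1 ->
  (\int[mu]_l (geom_kernelI (l, t) * c)%:E = (c * lmdens t)%:E)%E.
Proof.
move=> t01; under eq_integral do rewrite mulrC EFinM.
rewrite integralZl ?integral_geom_kernelI//.
apply/integrableP; split.
  by apply/measurable_EFinP; exact: measurable_geom_kernelI1.
under eq_integral do rewrite abse_EFin ger0_norm ?geom_kernelI_ge0//.
by rewrite integral_geom_kernelI// ltry.
Qed.

(** Integrating the kernel in [l] leaves [lmdens], against which the bounded [G] is integrable; this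
    gives absolute integrability on the plane. The measurability of the inner integral lets
    [logmean] pass from the closed interval to the open one. *)
Lemma Fubini_geom_kernel (G : R -> R) (M : R) :
  measurable_fun [set: measurableTypeR R] G ->
  (forall t, ~ 0 < t < 1 -> G t = 0) -> (forall t, `|G t| <= M) ->
  measurable_fun [set: measurableTypeR R]
    (fun l => \int[mu]_t (geom_kernelI (l, t) * G t)%:E)%E /\
  (\int[mu]_l \int[mu]_t (geom_kernelI (l, t) * G t)%:E =
   \int[mu]_(t in I01) (G t * lmdens t)%:E)%E.
Proof.
move=> mG G0 GM; pose f x := (geom_kernelI x * G x.2)%:E.
have mf : measurable_fun [set: measurableTypeR R * measurableTypeR R] f.
  apply/measurable_EFinP.
  apply: measurable_funM; first exact: measurable_geom_kernelI.
  exact: measurableT_comp.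
(* The form with [H] serves both for [G] and for its absolute value. *)
have GE (H : R -> R) : (forall t, G t = 0 -> H t = 0) ->
    (\int[mu]_t (\int[mu]_l (geom_kernelI (l, t) * H t)%:E) =
     \int[mu]_(t in I01) (H t * lmdens t)%:E)%E.
  move=> H0; rewrite [RHS]integral_mkcond; apply: eq_integral => t _.
  rewrite /patch; case: ifPn => [|/negP tI].
    by rewrite inE/= in_itv/= => t01; rewrite integral_geom_kernelI_cst.
  rewrite integral0_eq// => l _; rewrite H0 ?mulr0// G0//.
  by move=> t01; apply: tI; rewrite inE/= in_itv.
have iG := integrable_lmdens (measurable_funTS mG) (fun t _ => GM t).
have imf :
    (mu \x mu)%E.-integrable [set: measurableTypeR R * measurableTypeR R] f.
  apply/integrable21ltyP => //.
  under eq_integral => t _.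
    under eq_integral => l _.
      rewrite /f/= normrM.
      rewrite (_ : `|geom_kernelI (l, t)| * `|G t| =
        geom_kernelI (l, t) * `|G t|); last first.
        have [t01|/negP t01] := boolP (0 < t < 1).
          by rewrite ger0_norm ?geom_kernelI_ge0.
        by rewrite G0// normr0 !mulr0.
      over.
    over.
  rewrite (GE (fun t => `|G t|)); last by move=> t ->; rewrite normr0.
  have /integrableP[_] := iG.
  suff -> : (\int[mu]_(t in I01) (`|G t| * lmdens t)%:E =
      \int[mu]_(t in I01) `|(G t * lmdens t)%:E|)%E by [].
  apply: eq_integral => t; rewrite inE/= in_itv/= => t01.
  by rewrite normrM (ger0_norm (lmdens_ge0 t01)).
by split; [exact: measurable_fubini_F imf|rewrite (Fubini imf) -GE].
Qed.

(** * Suprema of affine functions *)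

(** On ]0, 1[ the function [F] is a supremum of affine functions below the chord from [a] to [b], so
    [D] is nonnegative and concave. The two slope inequalities are proved on each affine
    function. *)
Lemma sup_chord_bounds (S : set (R * R)) (a b : R) :
  S !=set0 -> (forall p, S p -> p.1 <= a /\ p.2 <= b) ->
  let F t := sup [set (1 - t) * p.1 + t * p.2 | p in S] in
  let D t := (1 - t) * a + t * b - F t in
  [/\ forall t, 0 < t < 1 ->
        ereal_sup [set ((1 - t) * p.1 + t * p.2)%:E | p in S] = (F t)%:E,
      forall t, 0 < t < 1 -> 0 <= D t,
      forall t r, 0 < t -> t <= r -> r < 1 -> t * D r <= r * D t,
      forall t r, 0 < r -> r <= t -> t < 1 -> (1 - t) * D r <= (1 - r) * D t &
      measurable_fun I01 F].
Proof.
move=> S0 Sab F D.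
pose V t := [set (1 - t) * p.1 + t * p.2 | p in S].
have V0 t : V t !=set0 by case: S0 => p Sp; exists ((1 - t) * p.1 + t * p.2), p.
have Vub t : 0 < t < 1 -> ubound (V t) ((1 - t) * a + t * b).
  move=> /andP[t0 t1] _ [p /Sab[pa pb] <-].
  by rewrite lerD// ler_wpM2l// ?subr_ge0 ltW.
have Fge t p : 0 < t < 1 -> S p -> (1 - t) * p.1 + t * p.2 <= F t.
  move=> t01 Sp; apply: ub_le_sup; last by exists p.
  by exists ((1 - t) * a + t * b); exact: Vub.
have Fle t y : (forall p, S p -> (1 - t) * p.1 + t * p.2 <= y) -> F t <= y.
  by move=> h; apply: (ge_sup (V0 t)) => _ [p Sp <-]; exact: h.
have FA t : 0 < t < 1 -> F t <= (1 - t) * a + t * b.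
  by move=> t01; apply: (ge_sup (V0 t)); exact: Vub.
split.
- move=> t t01; rewrite /F -(ereal_sup_EFin _ (V0 t)).
    by rewrite image_comp.
  by exists ((1 - t) * a + t * b); exact: Vub.
- by move=> t t01; rewrite subr_ge0 FA.
- move=> t r t0 tr r1; have r0 : 0 < r by exact: lt_le_trans tr.
  (* The value of an affine function at [t] combines its values at [r] and at [0], at most [F r] and
     [a], with weights [t / r] and [1 - t / r]. *)
  suff : F t <= t / r * F r + (1 - t / r) * a.
    rewrite -(ler_pM2l r0) (_ : r * (_ + _) = t * F r + (r - t) * a).
      by rewrite /D; nra.
    by field; rewrite gt_eqF.
  apply: Fle => p Sp; have [pa pb] := Sab _ Sp.
  have := Fge r p; rewrite r0 r1 => /(_ isT Sp) pF.
  have tr0 : 0 <= t / r by rewrite divr_ge0// ltW.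
  have tr1 : 0 <= 1 - t / r by rewrite subr_ge0 ler_pdivrMr// mul1r.
  have := ler_wpM2l tr0 pF; have := ler_wpM2l tr1 pa.
  rewrite (_ : t / r * (_ + _) = (t / r - t) * p.1 + t * p.2); last first.
    by field; rewrite gt_eqF.
  by lra.
- move=> t r r0 rt t1; have r1 : r < 1 by exact: le_lt_trans t1.
  have r10 : 0 < 1 - r by rewrite subr_gt0.
  (* Now the interpolation is between [r] and [1], where the value is at most [b]. *)
  suff : F t <= (1 - t) / (1 - r) * F r + (1 - (1 - t) / (1 - r)) * b.
    rewrite -(ler_pM2l r10).
    rewrite (_ : (1 - r) * (_ + _) = (1 - t) * F r + (t - r) * b).
      by rewrite /D; nra.
    by field; rewrite gt_eqF.
  apply: Fle => p Sp; have [pa pb] := Sab _ Sp.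
  have := Fge r p; rewrite r0 r1 => /(_ isT Sp) pF.
  have tr0 : 0 <= (1 - t) / (1 - r) by rewrite divr_ge0 ?subr_ge0// ltW.
  have tr1 : 0 <= 1 - (1 - t) / (1 - r).
    by rewrite subr_ge0 ler_pdivrMr// mul1r lerD2l lerN2.
  have := ler_wpM2l tr0 pF; have := ler_wpM2l tr1 pb.
  rewrite (_ : (1 - t) / (1 - r) * (_ + _) =
    (1 - t) * p.1 + ((1 - t) / (1 - r) - (1 - t)) * p.2); last first.
    by field; rewrite gt_eqF.
  by lra.
- move=> mI; apply: (measurability _ (RGenOInfty.measurableE R)) => //.
  move=> _ [_ [r ->] <-].
  (* A supremum of continuous functions exceeds [r] on a union of open sets, which is open even for
     an uncountable family. *)
  rewrite (_ : _ `&` _ = \bigcup_(p in S)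
      (`]0, 1[ `&` [set t : R | r < (1 - t) * p.1 + t * p.2])).
    apply: open_measurable; apply: bigcup_open => p Sp.
    apply: openI; first exact: interval_open.
    apply: (@open_comp _ _ (fun t : R => (1 - t) * p.1 + t * p.2)
      [set y | r < y]); last exact: open_gt.
    move=> t _; apply/differentiable_continuous/derivable1_diffP.
    exact: ex_derive.
  apply/seteqP; split=> t /=; rewrite in_itv/=.
    move=> [t01]; rewrite /preimage/= in_itv/= andbT => rF.
    have [_ [p Sp <-] rp] := sup_gt (V0 t) rF.
    by exists p => //; split => //; rewrite /= in_itv.
  move=> [p Sp [/=]]; rewrite in_itv/= => t01 rp; split => //.
  by rewrite /preimage/= in_itv/= andbT (lt_le_trans rp)// Fge.
Qed.

(** * The means at a point where [f] and [g] are finite *)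

Section harmonic.
Context (K : numFieldType) (re : K -> R) (E : tvsType K) (f g : E -> \bar R).
Context (x : E) (a b : R).
Hypotheses (fx : f x = a%:E) (gx : g x = b%:E).

(** The Fenchel-Young inequality at [x]; it excludes the value [-oo] for the conjugates. *)
Lemma conjugate_ge (h : E -> \bar R) (c : R) (xs : topdual E) :
  h x = c%:E -> ((re (xs x) - c)%:E <= conjugate re h xs)%E.
Proof.
by move=> hx; apply: ereal_sup_ubound; exists x => //; rewrite hx.
Qed.

(* The values at [t = 0] and [t = 1] of the affine functions of [t] of which
   [harm t f g x] is the supremum; linear forms at which one of the two
   conjugates is [+oo] contribute [-oo] and are left out. *)
Definition dual_endpoints : set (R * R) :=
  [set p | exists xs : topdual E, conjugate re f xs = (re (xs x) - p.1)%:E /\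
                                  conjugate re g xs = (re (xs x) - p.2)%:E].

Lemma dual_endpoints_le p : dual_endpoints p -> p.1 <= a /\ p.2 <= b.
Proof.
move=> [xs [fp gp]]; have := conjugate_ge xs fx; have := conjugate_ge xs gx.
by rewrite fp gp !lee_fin !lerD2l !lerN2.
Qed.

Lemma harm_sup t : 0 < t < 1 -> harm re t f g x =
  ereal_sup [set ((1 - t) * p.1 + t * p.2)%:E | p in dual_endpoints].
Proof.
move=> /andP[t0 t1]; have t10 : 0 < 1 - t by rewrite subr_gt0.
apply/eqP; rewrite eq_le; apply/andP; split.
  apply: ge_ereal_sup => _ [xs _ <-]; rewrite /arith /escale.
  rewrite (gt_eqF t0) (gt_eqF t10)/=.
  (* Without the value [-oo] four cases remain: both conjugates finite, which gives a pair in
     [dual_endpoints], or at least one equal to [+oo]. *)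
  have := conjugate_ge xs fx; have := conjugate_ge xs gx.
  case fu: (conjugate re f xs) => [u| |]//;
  case gv: (conjugate re g xs) => [v| |]// _ _.
  - apply: ereal_sup_ubound.
    exists (re (xs x) - u, re (xs x) - v).
      by exists xs; rewrite fu gv/= !subKr.
    transitivity (re (xs x) - ((1 - t) * u + t * v))%:E; last by [].
    by congr (_%:E) => /=; move: (re _) => y; ring.
  - by rewrite gt0_muley ?lte_fin//; exact: leNye.
  - by rewrite gt0_muley ?lte_fin//; exact: leNye.
  - by rewrite !gt0_muley ?lte_fin//; exact: leNye.
apply: ge_ereal_sup => _ [p [xs [fp gp]] <-].
apply: ereal_sup_ubound; exists xs => //.
rewrite /arith /escale (gt_eqF t0) (gt_eqF t10)/= fp gp.
transitivity (re (xs x) -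
  ((1 - t) * (re (xs x) - p.1) + t * (re (xs x) - p.2)))%:E.
  by [].
by congr (_%:E); move: (re _) => y; ring.
Qed.

Lemma sin_pi_gt0 l : 0 < l < 1 -> 0 < sin (pi * l) / pi :> R.
Proof.
move=> /andP[l0 l1]; rewrite divr_gt0 ?pi_gt0// sin_gt0_pi//.
rewrite mulr_gt0 ?pi_gt0//=.
by rewrite gtr_pMr ?pi_gt0.
Qed.

Lemma geom_integral (F : R -> R) l :
  (forall t, 0 < t < 1 -> harm re t f g x = (F t)%:E) ->
  measurable_fun I01 F -> 0 < l < 1 ->
  geom re l f g x = (\int[mu]_t (geom_kernelI (l, t) * (F \_ I01) t)%:E)%E.
Proof.
move=> HF mF l01; have /andP[l0 l1] := l01.
have c0 := sin_pi_gt0 l01; set c := sin (pi * l) / pi in c0.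
rewrite /geom (gt_eqF l0) (lt_eqF l1) -/c /escale (gt_eqF c0)/=.
(* The kernel already contains the factor [c] that stands outside the integral, hence the [c^-1]. *)
have -> : (\int[mu]_(t in `]0%R, 1%R[) escale (t `^ (l - 1) / (1 - t) `^ l)%R
    (harm re t f g x) =
    \int[mu]_(t in I01) (c^-1 * (geom_kernelI (l, t) * F t))%:E)%E.
  apply: eq_integral => t; rewrite inE/= in_itv/= => t01.
  rewrite HF// /escale andbF -EFinM geom_kernelIE// indicE mem_set ?mul1r.
    by rewrite /geom_kernel -/c -[c * _ * _]mulrA mulKf// gt_eqF.
  by rewrite /= in_itv.
rewrite -integral_cstM//; last first.
  apply/measurable_EFinP; apply: measurable_funM => //.
  apply: measurable_funM => //.
  exact: measurable_funTS (measurable_geom_kernelI2 l).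
rewrite integral_mkcond; apply: eq_integral => t _; rewrite /patch.
case: ifPn => _; last by rewrite mulr0.
by rewrite -EFinM mulVKf// gt_eqF.
Qed.

Lemma logmean_lmdens (F : R -> R) (M : R) :
  (forall t, 0 < t < 1 -> harm re t f g x = (F t)%:E) ->
  measurable_fun I01 F -> (forall t, 0 < t < 1 -> `|F t| <= M) ->
  logmean re f g x = (\int[mu]_(t in I01) (F t * lmdens t)%:E)%E.
Proof.
move=> HF mF FM; pose G := F \_ I01.
have mG : measurable_fun [set: measurableTypeR R] G.
  by apply/(measurable_restrictT _ _).1.
have G0 t : ~ 0 < t < 1 -> G t = 0.
  by move=> t01; rewrite /G patchE memNset//= in_itv.
have GF t : 0 < t < 1 -> G t = F t.
  by move=> t01; rewrite /G patchE mem_set//= in_itv.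
have GM t : `|G t| <= `|M|.
  have [t01|/negP t01] := boolP (0 < t < 1).
    by rewrite GF// (le_trans (FM _ t01))// ler_norm.
  by rewrite G0// normr0.
have [mI FI] := Fubini_geom_kernel mG G0 GM.
have gE l : l \in I01 ->
    (\int[mu]_t (geom_kernelI (l, t) * G t)%:E)%E = geom re l f g x.
  by rewrite inE/= in_itv/= => l01; rewrite (geom_integral HF).
(* The conventional values of [geom] at the weights [0] and [1] disappear with the endpoints, a null
   set. *)
rewrite /logmean integral_itv_bndoo; last first.
  by apply: (eq_measurable_fun _ gE); exact: measurable_funTS.
transitivity (\int[mu]_(t in I01) (G t * lmdens t)%:E)%E; last first.
  by apply: eq_integral => t; rewrite inE/= in_itv/= => t01; rewrite GF.
rewrite -FI [LHS]integral_mkcond; apply: eq_integral => l _; rewrite patchE.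
case: ifPn => lI; first by rewrite gE.
rewrite integral0_eq// => t _; rewrite /geom_kernelI/= indicE (negbTE lI).
by rewrite mul0r mul0r.
Qed.

(** Covers the case where no linear form makes both conjugates finite. The weights in [geom] are
    positive and ]0, 1[ has measure [1], so [-oo] passes through both integrals. *)
Lemma logmean_eqNy :
  (forall t, 0 < t < 1 -> harm re t f g x = -oo%E) -> logmean re f g x = -oo%E.
Proof.
move=> HN.
have iNy : (\int[mu]_(t in I01) (cst -oo) t = -oo)%E.
  transitivity (-oo * mu I01)%E; first exact: integral_cst.
  by rewrite lebesgue_measure_itv/= lte_fin ltr01 -EFinB subr0 mule1.
have gN l : l \in I01 -> geom re l f g x = -oo%E.
  rewrite inE/= in_itv/= => l01; have /andP[l0 l1] := l01.
  rewrite /geom (gt_eqF l0) (lt_eqF l1) /escale.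
  under eq_integral => t.
    rewrite inE/= in_itv/= => t01; rewrite HN// andbF gt0_muleNy; last first.
      have /andP[t0 t1] := t01.
      by rewrite lte_fin divr_gt0 ?powR_gt0// subr_gt0.
    over.
  rewrite iNy gt0_muleNy//; last by rewrite lte_fin sin_pi_gt0.
  by rewrite andbF.
rewrite /logmean integral_itv_bndoo; last first.
  by apply: (eq_measurable_fun (cst -oo%E)) => // l /gN.
by rewrite -[RHS]iNy; apply: eq_integral.
Qed.

Lemma logmean_gap (s : R) : dual_endpoints !=set0 -> 0 < s < 1 ->
  exists d L : R, [/\ harm re s f g x = ((1 - s) * a + s * b - d)%:E,
    logmean re f g x = L%:E, 0 <= d &
    (2^-1 - Icst s) * ((s * (1 - s))^-1 * d) <= (2^-1 * a + 2^-1 * b) - L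
      <= Icst s * ((s * (1 - s))^-1 * d)].
Proof.
move=> S0 s01; have [] := sup_chord_bounds S0 dual_endpoints_le.
set F := fun t : R => sup _; set D := fun t => (1 - t) * a + t * b - F t.
move=> HF D0 Dl Dr mF.
have hF t : 0 < t < 1 -> harm re t f g x = (F t)%:E.
  by move=> t01; rewrite harm_sup// HF.
(* The slope inequalities at the midpoint bound [D], and hence [F], which makes both integrable
   against the density. *)
have DM t : 0 < t < 1 -> `|D t| <= 2 * D 2^-1.
  move=> t01; rewrite ger0_norm ?D0//; have := D0 t t01.
  have /andP[t0 t1] := t01.
  have h0 : 0 <= D 2^-1 by apply: D0; apply/andP; split; lra.
  have [th|ht] := leP t 2^-1.
    have : (1 - 2^-1) * D t <= (1 - t) * D 2^-1 by apply: Dr => //; lra.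
    by move: h0; move: (D t) (D _) => y z; nra.
  have : 2^-1 * D t <= t * D 2^-1 by apply: Dl => //; lra.
  by move: h0; move: (D t) (D _) => y z; nra.
have mA : measurable_fun I01 (fun t : R => (1 - t) * a + t * b).
  apply: measurable_funD; apply: measurable_funM => //.
  exact: measurable_funB.
have mD : measurable_fun I01 D by exact: measurable_funB.
have FM t : 0 < t < 1 -> `|F t| <= `|a| + `|b| + 2 * D 2^-1.
  move=> t01; rewrite (_ : F t = (1 - t) * a + t * b - D t); last first.
    by rewrite /D subKr.
  rewrite (le_trans (ler_normB _ _))// lerD ?DM//.
  have /andP[t0 t1] := t01; rewrite (le_trans (ler_normD _ _))// !normrM.
  rewrite (gtr0_norm t0) gtr0_norm ?subr_gt0//.
  by rewrite lerD// ler_piMl// ltW// ltrBlDr ltrDl.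
have iD := integrable_lmdens mD DM.
have iF := integrable_lmdens mF FM.
have fF : (\int[mu]_(t in I01) (F t * lmdens t)%:E)%E \is a fin_num.
  by apply: integrable_fin_num iF.
exists (D s), (\int[mu]_(t in I01) (F t * lmdens t)).
have -> : 2^-1 * a + 2^-1 * b - \int[mu]_(t in I01) (F t * lmdens t) =
    \int[mu]_(t in I01) (D t * lmdens t).
  have iZ (c : R) (h : R -> R) : mu.-integrable I01 (EFin \o h) ->
      mu.-integrable I01 (EFin \o (fun t => c * h t)).
    move=> ih; rewrite (_ : EFin \o _ = fun t => (c%:E * (EFin \o h) t)%E)//.
    exact: integrableZl.
  have i1 := iZ a _ integrable_lmdens_onem.
  have i2 := iZ b _ integrable_lmdens_id.
  have i12 : mu.-integrable I01
      (EFin \o (fun t => a * ((1 - t) * lmdens t) + b * (t * lmdens t))).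
    pose h1 t := a * ((1 - t) * lmdens t); pose h2 t := b * (t * lmdens t).
    rewrite (_ : EFin \o _ = ((EFin \o h1) \+ (EFin \o h2))%E)//.
    exact: integrableD.
  rewrite (mulrC 2^-1 a) (mulrC 2^-1 b).
  (* The two factors [2^-1] become the integrals of [1 - t] and of [t] against the density, so the
     arithmetic mean is the integral of the chord. *)
  rewrite -{1}Rintegral_lmdens_onem -Rintegral_lmdens_id.
  rewrite -RintegralZl//; last exact: integrable_lmdens_onem.
  rewrite -RintegralZl//; last exact: integrable_lmdens_id.
  rewrite -RintegralD// -RintegralB//; apply: eq_Rintegral => t _.
  by rewrite /D; ring.
split; [by rewrite hF// /D subKr| |exact: D0|exact: gap_bounds].
by rewrite (logmean_lmdens hF mF FM) /Rintegral fineK.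
Qed.

End harmonic.

(** * Infinite values and the conclusion *)

Lemma escale_y (c : R) : 0 <= c -> escale c +oo%E = +oo%E.
Proof.
rewrite /escale eqxx andbT le_eqVlt => /predU1P[<-|c0]; first by rewrite eqxx.
by rewrite (gt_eqF c0) gt0_muley ?lte_fin.
Qed.

Lemma escale_EFin (c y : R) : escale c y%:E = (c * y)%:E.
Proof. by rewrite /escale andbF EFinM. Qed.

Lemma arith_y (T : Type) (f g : T -> \bar R) (x : T) l : 0 < l < 1 ->
  f x = +oo%E \/ g x = +oo%E -> arith l f g x = +oo%E.
Proof.
move=> /andP[l0 l1]; rewrite /arith.
move=> -[->|->]; rewrite escale_y ?subr_ge0 1?ltW//.
by case: (escale _ _).
Qed.

End logarithmic_mean.

Theorem theorem7p2 (R : realType) (K : numFieldType) (re : K -> R)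
    (hK : real_or_complex re) (E : tvsType K) (f g : E -> \bar R)
    (hf : Gamma0 re f) (hg : Gamma0 re g) (s : R) (hs : 0 < s < 1) :
  let Q := fun x : E =>
    escale (s * (1 - s))^-1 (arith s f g x - harm re s f g x)%dE in
  forall x : E,
    [/\ (0 <= escale (2^-1 - Icst s) (Q x))%E,
        (escale (2^-1 - Icst s) (Q x)
           <= (arith 2^-1 f g x - logmean re f g x)%dE)%E
      & ((arith 2^-1 f g x - logmean re f g x)%dE
           <= escale (Icst s) (Q x))%E].
Proof.
move=> Q x; have /andP[s0 s1] := hs.
have c0 : 0 < s * (1 - s) by rewrite mulr_gt0 ?subr_gt0.
have /andP[I0 I2] := Icst_itv hs.
have I2' : 0 <= 2^-1 - Icst s by rewrite subr_ge0.
have h2 : 0 < (2^-1 : R) < 1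
  by rewrite invr_gt0 ltr0n invf_lt1 ?ltr0n ?ltr1n.
(* The two coefficients are only known to be nonnegative; by the convention [0 * (+oo) = +oo] both
   outer bounds are [+oo] even if a coefficient is [0]. *)
have infty : Q x = +oo%E ->
    (arith 2^-1 f g x - logmean re f g x)%dE = +oo%E ->
    [/\ (0 <= escale (2^-1 - Icst s) (Q x))%E,
        (escale (2^-1 - Icst s) (Q x)
           <= (arith 2^-1 f g x - logmean re f g x)%dE)%E
      & ((arith 2^-1 f g x - logmean re f g x)%dE
           <= escale (Icst s) (Q x))%E].
  by move=> -> ->; rewrite !escale_y// !leey.
have [_ _ [fN _]] := hf; have [_ _ [gN _]] := hg.
(* If one value is infinite, the arithmetic means are [+oo], and they remain so whatever is
   subtracted. *)
have [fgy|fgy] := pselect (f x = +oo%E \/ g x = +oo%E).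
  apply: infty; last by rewrite arith_y.
  by rewrite /Q arith_y// escale_y// invr_ge0 ltW.
case fx: (f x) (fN x) => [a| |]// _; last by case: fgy; left.
case gx: (g x) (gN x) => [b| |]// _; last by case: fgy; right.
have arithE l : arith l f g x = ((1 - l) * a + l * b)%:E.
  by rewrite /arith fx gx !escale_EFin.
have [S0|/nonemptyPn S0] :=
  pselect (dual_endpoints re f g x !=set0)%classic.
  have [d [L [hE LE d0 /andP[lo hi]]]] := logmean_gap fx gx S0 hs.
  have QE : Q x = ((s * (1 - s))^-1 * d)%:E.
    rewrite /Q arithE hE -escale_EFin; congr escale.
    transitivity ((1 - s) * a + s * b - ((1 - s) * a + s * b - d))%:E.
      by [].
    by rewrite subKr.
  rewrite QE LE !escale_EFin arithE.
  have -> : (((1 - 2^-1) * a + 2^-1 * b)%:E - L%:E)%dE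
      = (2^-1 * a + 2^-1 * b - L)%:E.
    transitivity ((1 - 2^-1) * a + 2^-1 * b - L)%:E; first by [].
    by congr (_%:E); lra.
  by split; rewrite lee_fin// !mulr_ge0// ?invr_ge0 ltW.
(* The supremum over the empty set is [-oo]; subtracted from a finite arithmetic mean it gives
   [+oo]. *)
have hNy t : 0 < t < 1 -> harm re t f g x = -oo%E.
  by move=> t01; rewrite (harm_sup re fx gx)// S0 image_set0 ereal_sup0.
apply: infty.
  by rewrite /Q hNy// arithE escale_y// invr_ge0 ltW.
by rewrite (logmean_eqNy hNy) arithE.
Qed.
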